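(* Let $T\colon\mathsf{Set}\to\mathsf{Set}$ be a functor and let $L$ be a finitarily separable fuzzy lax extension of $T$. Then there exists a set $\Lambda$ of monotone (finitary, fuzzy) predicate liftings for $T$ that preserves nonexpansiveness with respect to $L$ and is separating for $L$, i.e. $L=K_\Lambda$, where $K_\Lambda$ is the Kantorovich lifting. Moreover, $L$ is nonexpansive if and only if $\Lambda$ can be chosen in such a way that all $\lambda\in\Lambda$ are nonexpansive.
   Context: A fuzzy relation between sets $A$ and $B$ is a map $R\colon A\times B\to[0,1]$; fuzzy relations are ordered pointwise, and the converse is $R^\circ(b,a)=R(a,b)$. For $x,y\in[0,1]$: $x\oplus y=\min(x+y,1)$, $x\ominus y=\max(x-y,0)$. Composition: $(R;S)(a,c)=\inf_{b\in B}R(a,b)\oplus S(b,c)$ for $R\colon A\times B\to[0,1]$, $S\colon B\times C\to[0,1]$ (infima and suprema are taken in $[0,1]$). For $f\colon A\to B$ and $\epsilon\in[0,1]$, $\mathrm{Gr}_{\epsilon,f}(a,b)=\epsilon$ if $f(a)=b$ and $1$ otherwise; $\mathrm{Gr}_f=\mathrm{Gr}_{0,f}$, $\Delta_{\epsilon,A}=\mathrm{Gr}_{\epsilon,\mathrm{id}_A}$, $\Delta_A=\Delta_{0,A}$. A fuzzy lax extension $L$ of $T$ assigns to each fuzzy relation $R$ between $A$ and $B$ (for all sets $A,B$) a fuzzy relation $LR$ between $TA$ and $TB$ such that (L1) $R_1\le R_2$ implies $LR_1\le LR_2$; (L2) $L(R;S)\le LR;LS$; (L3) $L\,\mathrm{Gr}_f\le\mathrm{Gr}_{Tf}$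 and $L(\mathrm{Gr}_f^\circ)\le\mathrm{Gr}_{Tf}^\circ$ for every function $f$. It is nonexpansive if $L\Delta_{\epsilon,A}\le\Delta_{\epsilon,TA}$ for all sets $A$ and all $\epsilon>0$. $T_\omega X=\bigcup\{Ti[TY]\mid Y\subseteq X\text{ finite}, i\colon Y\to X\text{ inclusion}\}\subseteq TX$. $L$ is finitarily separable if for every set $X$, every $t\in TX$ and every $\epsilon>0$ there is $s\in T_\omega X$ with $L\Delta_X(t,s)\le\epsilon$ and $L\Delta_X(s,t)\le\epsilon$. Write $\mathcal{Q}X$ for the set of functions $X\to[0,1]$, a contravariant functor by precomposition. An $n$-ary predicate lifting ($n\in\mathbb{N}$) is a natural transformation $\lambda\colon\mathcal{Q}^n\Rightarrow\mathcal{Q}\circ T$, i.e. maps $\lambda_X\colon(\mathcal{Q}X)^n\to\mathcal{Q}(TX)$ with $\lambda_X(f_1\circ h,\dots,f_n\circ h)=\lambda_Y(f_1,\dots,f_n)\circ Th$ for $h\colon X\to Y$. It is monotone if $f_i\le g_i$ for all $i$ implies $\lambda_X(f_1,\dots,f_n)\le\lambda_X(g_1,\dots,g_n)$; it is nonexpansive if $\|\lambda_X(f_1,\dots,f_n)-\lambda_X(g_1,\dots,g_n)\|_\infty\le\max_i\|f_i-g_i\|_\infty$ always. For a fuzzy relation $R$ between $A$ and $B$, a pair $(f,g)$ with $f\in\mathcal{Q}A$, $g\in\mathcal{Q}B$ is $R$-nonexpansive if $f(a)-g(b)\le R(a,b)$ for all $a\in A,b\in B$. For a set $\Lambda$ of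 monotone predicate liftings, the Kantorovich lifting is $$K_\Lambda R(t_1,t_2)=\sup\{\lambda_A(f_1,\dots,f_n)(t_1)\ominus\lambda_B(g_1,\dots,g_n)(t_2)\mid \lambda\in\Lambda\ n\text{-ary},\ (f_1,g_1),\dots,(f_n,g_n)\ R\text{-nonexpansive}\}$$ for $t_1\in TA$, $t_2\in TB$. $\Lambda$ preserves nonexpansiveness (with respect to $L$) if for each $n$-ary $\lambda\in\Lambda$, each fuzzy relation $R$ between sets $A$ and $B$ and all $R$-nonexpansive pairs $(f_1,g_1),\dots,(f_n,g_n)$, the pair $(\lambda_A(f_1,\dots,f_n),\lambda_B(g_1,\dots,g_n))$ is $LR$-nonexpansive. $\Lambda$ is separating for $L$ if $K_\Lambda R\ge LR$ for all fuzzy relations $R$. *)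

(* Defs.v *)
From HB Require Import structures.
From mathcomp Require Import all_boot all_order all_algebra.
From mathcomp Require Import interval_inference.
From mathcomp Require Import boolp classical_sets functions cardinality reals.

Set Implicit Arguments.
Unset Strict Implicit.
Unset Printing Implicit Defensive.

Import Order.TTheory GRing.Theory Num.Theory.

Local Open Scope classical_set_scope.
Local Open Scope ring_scope.

(* A single fixed universe, so that functors below are genuine endofunctors:
   [T A] lives at the same level as [A]. *)
Definition Sets := Type.

Section UnitInterval.
Variable R : realType.
Implicit Types (x y : {i01 R}) (S : set {i01 R}).

Definition oplus x y : {i01 R} := (Num.min (x%:num + y%:num) 1)%:i01.

Fact ominus_ge0 x y : 0 <= Num.max (x%:num - y%:num) 0.
Proof. by rewrite le_max lexx orbT. Qed.

Fact ominus_le1 x y : Num.max (x%:num - y%:num) 0 <= 1.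
Proof. by rewrite ge_max ler01 andbT lerBlDr (le_trans (y := 1)) // lerDl. Qed.

Definition ominus x y : {i01 R} := Itv01 (ominus_ge0 x y) (ominus_le1 x y).

(* Infima and suprema in the complete lattice [0,1]: adjoining 1 (resp. 0)
   leaves them unchanged for nonempty S and gives the empty infimum 1 (resp.
   the empty supremum 0), whereas mathcomp's [inf set0] is 0. *)
Definition with1 S : set R := 1 |` [set x%:num | x in S].
Definition with0 S : set R := 0 |` [set x%:num | x in S].

Fact inf01_ge0 S : 0 <= inf (with1 S).
Proof. by apply: lb_le_inf => [|_ [->|[x _ <-]]] //; exists 1; left. Qed.

Fact inf01_le1 S : inf (with1 S) <= 1.
Proof. by apply: ge_inf; [exists 0 => _ [->|[x _ <-]] | left]. Qed.

Definition inf01 S : {i01 R} := Itv01 (inf01_ge0 S) (inf01_le1 S).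

Fact sup01_ge0 S : 0 <= sup (with0 S).
Proof. by apply: ub_le_sup; [exists 1 => _ [->|[x _ <-]] | left]. Qed.

Fact sup01_le1 S : sup (with0 S) <= 1.
Proof. by apply: ge_sup => [|_ [->|[x _ <-]]] //; exists 0; left. Qed.

Definition sup01 S : {i01 R} := Itv01 (sup01_ge0 S) (sup01_le1 S).

End UnitInterval.

Record set_functor := SetFunctor {
  fobj :> Sets -> Sets;
  functor_map : forall A B : Sets, (A -> B) -> fobj A -> fobj B;
  functor_map_id : forall A : Sets, functor_map (@id A) = id;
  functor_map_comp : forall (A B C : Sets) (g : B -> C) (f : A -> B),
    functor_map (g \o f) = functor_map g \o functor_map f
}.
Arguments functor_map T {A B} f t : rename.

Section FuzzyRelations.
Variable R : realType.

Definition fuzzy_rel (A B : Sets) : Sets := A -> B -> {i01 R}.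

Definition fuzzy_le (A B : Sets) (r s : fuzzy_rel A B) : Prop :=
  forall a b, r a b <= s a b.

Definition converse (A B : Sets) (r : fuzzy_rel A B) : fuzzy_rel B A :=
  fun b a => r a b.

Definition fuzzy_comp (A B C : Sets) (r : fuzzy_rel A B) (s : fuzzy_rel B C) :
    fuzzy_rel A C :=
  fun a c => inf01 [set oplus (r a b) (s b c) | b in [set: B]].

Definition fuzzy_graph_eps (eps : {i01 R}) (A B : Sets) (f : A -> B) :
    fuzzy_rel A B :=
  fun a b => if `[< f a = b >] then eps else 1%:i01.

Definition fuzzy_graph (A B : Sets) (f : A -> B) : fuzzy_rel A B :=
  fuzzy_graph_eps 0%:i01 f.

Definition diag_eps (eps : {i01 R}) (A : Sets) : fuzzy_rel A A :=
  fuzzy_graph_eps eps (@id A).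
Arguments diag_eps eps A : clear implicits.

Definition diag (A : Sets) : fuzzy_rel A A := diag_eps 0%:i01 A.

End FuzzyRelations.

Arguments fuzzy_graph R {A B} f _ _.
Arguments diag_eps {R} eps A _ _.
Arguments diag R A _ _ : clear implicits.

Record fuzzy_lax_extension (R : realType) (T : set_functor) :=
  FuzzyLaxExtension {
  lext :> forall A B : Sets, fuzzy_rel R A B -> fuzzy_rel R (T A) (T B);
  lext_mono : forall (A B : Sets) (r1 r2 : fuzzy_rel R A B),
    fuzzy_le r1 r2 -> fuzzy_le (lext r1) (lext r2);
  lext_comp : forall (A B C : Sets) (r : fuzzy_rel R A B) (s : fuzzy_rel R B C),
    fuzzy_le (lext (fuzzy_comp r s)) (fuzzy_comp (lext r) (lext s));
  lext_graph : forall (A B : Sets) (f : A -> B),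
    fuzzy_le (lext (fuzzy_graph R f)) (fuzzy_graph R (functor_map T f));
  lext_graph_conv : forall (A B : Sets) (f : A -> B),
    fuzzy_le (lext (converse (fuzzy_graph R f)))
      (converse (fuzzy_graph R (functor_map T f)))
}.
Arguments lext {R T} L {A B} r : rename.

Section LaxExtensionProperties.
Variables (R : realType) (T : set_functor) (L : fuzzy_lax_extension R T).

Definition nonexpansive_extension : Prop :=
  forall (A : Sets) (eps : {i01 R}), 0 < eps%:num ->
    fuzzy_le (lext L (diag_eps eps A)) (diag_eps eps (T A)).

(* [Y] is coerced to its subtype [set_type Y], and [val] is the inclusion. *)
Definition finitary_part (X : Sets) : set (T X) :=
  [set t | exists Y : set X,
     finite_set Y /\ exists s : T Y, functor_map T (val : Y -> X) s = t].

Definition finitarily_separable : Prop :=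
  forall (X : Sets) (t : T X) (eps : R), 0 < eps ->
    exists s : T X, [/\ finitary_part s,
      (lext L (diag R X) t s)%:num <= eps &
      (lext L (diag R X) s t)%:num <= eps].

End LaxExtensionProperties.

Section PredicateLiftings.
Variables (R : realType) (T : set_functor).

Definition fpred (X : Sets) : Sets := X -> {i01 R}.

Record predicate_lifting (n : nat) := PredicateLifting {
  plift :> forall X : Sets, ('I_n -> fpred X) -> fpred (T X);
  plift_natural : forall (X Y : Sets) (h : X -> Y) (f : 'I_n -> fpred Y),
    plift (fun i => f i \o h) = plift f \o functor_map T h
}.
Arguments plift {n} lam {X} f : rename.

Definition fpred_le (X : Sets) (f g : fpred X) : Prop := forall x, f x <= g x.

Definition monotone_lifting n (lam : predicate_lifting n) : Prop :=
  forall (X : Sets) (f g : 'I_n -> fpred X),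
    (forall i, fpred_le (f i) (g i)) -> fpred_le (plift lam f) (plift lam g).

(* || f - g ||_oo; it is 0 when X is empty. *)
Definition sup_dist (X : Sets) (f g : fpred X) : R :=
  sup [set `|(f x)%:num - (g x)%:num| | x in [set: X]].

Definition nonexpansive_lifting n (lam : predicate_lifting n) : Prop :=
  forall (X : Sets) (f g : 'I_n -> fpred X),
    sup_dist (plift lam f) (plift lam g) <=
      \big[Num.max/0]_(i < n) sup_dist (f i) (g i).

Definition nonexpansive_pair (A B : Sets) (r : fuzzy_rel R A B)
    (f : fpred A) (g : fpred B) : Prop :=
  forall a b, (f a)%:num - (g b)%:num <= (r a b)%:num.

(* A set of predicate liftings of arbitrary finite arities. There is no size
   issue: by Yoneda, the n-ary predicate liftings correspond to the functions
   T ([0,1]^n) -> [0,1]. *)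
Definition lifting_set := forall n, predicate_lifting n -> Prop.

Implicit Type Lam : lifting_set.

Definition all_monotone Lam : Prop :=
  forall n (lam : predicate_lifting n), Lam n lam -> monotone_lifting lam.

Definition all_nonexpansive Lam : Prop :=
  forall n (lam : predicate_lifting n), Lam n lam -> nonexpansive_lifting lam.

Definition kantorovich Lam (A B : Sets) (r : fuzzy_rel R A B) :
    fuzzy_rel R (T A) (T B) :=
  fun t1 t2 => sup01 [set v | exists (n : nat) (lam : predicate_lifting n)
    (f : 'I_n -> fpred A) (g : 'I_n -> fpred B),
    [/\ Lam n lam, forall i, nonexpansive_pair r (f i) (g i) &
        v = ominus (plift lam f t1) (plift lam g t2)]].

Variable L : fuzzy_lax_extension R T.

Definition preserves_nonexpansiveness Lam : Prop :=
  forall n (lam : predicate_lifting n), Lam n lam ->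
  forall (A B : Sets) (r : fuzzy_rel R A B)
    (f : 'I_n -> fpred A) (g : 'I_n -> fpred B),
    (forall i, nonexpansive_pair r (f i) (g i)) ->
    nonexpansive_pair (lext L r) (plift lam f) (plift lam g).

Definition separating Lam : Prop :=
  forall (A B : Sets) (r : fuzzy_rel R A B),
    fuzzy_le (lext L r) (kantorovich Lam r).

End PredicateLiftings.

Arguments plift {R T n} lam {X} f : rename.

(* Main.v *)
(** Reading a tuple [f] of fuzzy predicates on [X] as a fuzzy relation between
    [X] and ['I_n], every [s : T 'I_n] induces the Moss lifting
    [f |-> L f (-, s)]. The laxity axioms make [L] commute with reindexing along
    functions, which gives naturality, and [L (r; f) <= L r; L f] gives
    preservation of nonexpansiveness. For separation at [(t1, t2)], pick a finitary
    [s] close to [t2] and a finite family [e] supporting it: the pairs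
    [(r (-, e i), Delta (-, e i))] are [r]-nonexpansive, and the Moss lifting of
    [s] sends them to [L r (t1, s)] and [L Delta (t2, s)], so their difference is
    [L r (t1, t2)] up to [2 eps]. *)
Require Import Defs.
From mathcomp Require Import all_boot all_order all_algebra.
From mathcomp Require Import interval_inference boolp classical_sets reals.
From mathcomp Require Import cardinality lra.

Set Implicit Arguments.
Unset Strict Implicit.
Unset Printing Implicit Defensive.

Import Order.TTheory GRing.Theory Num.Theory.

Local Open Scope classical_set_scope.
Local Open Scope ring_scope.

(** * Bounds for infima, suprema, composites and distances with values in [0,1] *)

Section UnitIntervalTheory.
Variable R : realType.
Implicit Types (x y eps : {i01 R}) (S : set {i01 R}).

Lemma i01_ge0 x : 0 <= x%:num.
Proof. exact: ge0. Qed.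

Lemma i01_le1 x : x%:num <= 1.
Proof. exact: le1. Qed.

Lemma inf01_le S x : S x -> (inf01 S)%:num <= x%:num.
Proof.
move=> Sx; apply: ge_inf; last by right; exists x.
by exists 0 => _ [->|[y _ <-]]; rewrite ?ler01 // i01_ge0.
Qed.

Lemma le_inf01 S x : (forall y, S y -> x%:num <= y%:num) ->
  x%:num <= (inf01 S)%:num.
Proof.
move=> xS; apply: lb_le_inf; first by exists 1; left.
by move=> _ [->|[y Sy <-]]; [exact: i01_le1 | exact: xS].
Qed.

Lemma sup01_ge S x : S x -> x%:num <= (sup01 S)%:num.
Proof.
move=> Sx; apply: ub_le_sup; last by right; exists x.
by exists 1 => _ [->|[y _ <-]]; rewrite ?ler01 // i01_le1.
Qed.

Lemma sup01_le S x : (forall y, S y -> y%:num <= x%:num) ->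
  (sup01 S)%:num <= x%:num.
Proof.
move=> Sx; apply: ge_sup; first by exists 0; left.
by move=> _ [->|[y Sy <-]]; [exact: i01_ge0 | exact: Sx].
Qed.

Lemma le_fuzzy_comp (A B C : Sets) (r : fuzzy_rel R A B) (s : fuzzy_rel R B C)
    x a c :
  (forall b, x%:num <= (r a b)%:num + (s b c)%:num) ->
  x%:num <= (fuzzy_comp r s a c)%:num.
Proof.
move=> xrs; apply: le_inf01 => _ [b _ <-] /=.
by rewrite le_min xrs i01_le1.
Qed.

Lemma fuzzy_comp_le (A B C : Sets) (r : fuzzy_rel R A B) (s : fuzzy_rel R B C)
    a b c :
  (fuzzy_comp r s a c)%:num <= (r a b)%:num + (s b c)%:num.
Proof.
apply: (le_trans (y := (oplus (r a b) (s b c))%:num)).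
  by apply: inf01_le; exists b.
by rewrite /= ge_min lexx.
Qed.

Lemma fuzzy_graph_epsE eps (A B : Sets) (f : A -> B) a :
  fuzzy_graph_eps eps f a (f a) = eps.
Proof. by rewrite /fuzzy_graph_eps asboolT. Qed.

Lemma diag_epsE eps (A : Sets) (a : A) : diag_eps eps A a a = eps.
Proof. exact: fuzzy_graph_epsE. Qed.

Lemma fuzzy_graph_eps_neq eps (A B : Sets) (f : A -> B) a b :
  f a <> b -> fuzzy_graph_eps eps f a b = 1%:i01.
Proof. by move=> fab; rewrite /fuzzy_graph_eps asboolF. Qed.

(** Off the graph the relation takes the value 1, which dominates every [x]; only the points of the
    graph need an argument. *)
Lemma le_fuzzy_graph_epsD (A B : Sets) (f : A -> B) eps x y a b :
  (f a = b -> x%:num <= eps%:num + y%:num) ->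
  x%:num <= (fuzzy_graph_eps eps f a b)%:num + y%:num.
Proof.
move=> xy; have [fab|fab] := pselect (f a = b).
  by rewrite -{1}fab fuzzy_graph_epsE; exact: xy.
rewrite fuzzy_graph_eps_neq //=.
by have := i01_le1 x; have := i01_ge0 y; lra.
Qed.

Lemma sup_dist_ge (X : Sets) (f g : fpred R X) (x : X) :
  `|(f x)%:num - (g x)%:num| <= sup_dist f g.
Proof.
apply: ub_le_sup; last by exists x.
exists 1 => _ [y _ <-]; rewrite ler_norml.
have := i01_ge0 (f y); have := i01_le1 (f y).
have := i01_ge0 (g y); have := i01_le1 (g y).
by move=> *; apply/andP; split; lra.
Qed.

Lemma sup_dist_le (X : Sets) (f g : fpred R X) (M : R) : 0 <= M ->
  (forall x : X, `|(f x)%:num - (g x)%:num| <= M) -> sup_dist f g <= M.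
Proof.
move=> M0 fgM; rewrite /sup_dist.
(* On an empty [X] the supremum is over the empty set and has the default value 0, which is where
   [0 <= M] enters. *)
have [->|/set0P ne] := eqVneq
    [set `|(f z)%:num - (g z)%:num| | z in [set: X]] set0.
  by rewrite sup0.
by apply: ge_sup => // _ [x _ <-].
Qed.

Lemma bigmax_sup_dist_ge0 (X : Sets) n (f g : 'I_n -> fpred R X) :
  0 <= \big[Num.max/0]_(i < n) sup_dist (f i) (g i).
Proof. by elim/big_rec: _ => // i x _ x0; rewrite le_max x0 orbT. Qed.

Lemma le_bigmax_sup_dist (X : Sets) n (f g : 'I_n -> fpred R X) i (x : X) :
  `|(f i x)%:num - (g i x)%:num| <=
    \big[Num.max/0]_(i < n) sup_dist (f i) (g i).
Proof.
apply: le_trans (sup_dist_ge _ _ _) _.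
exact: (le_bigmax_cond 0 (fun i => sup_dist (f i) (g i)) (P := xpredT)).
Qed.

End UnitIntervalTheory.

(** With [v] an enumeration and [u] its inverse, [u \o v = id] makes every element of [T Y] factor
    through [T 'I_n]. An empty [Y] gives [n = 0]. *)
Lemma finite_set_retract (X : Type) (Y : set X) : finite_set Y ->
  exists n (u : 'I_n -> Y) (v : Y -> 'I_n), u \o v = id.
Proof.
move=> [n /card_set_bijP[f [fY finj fsurj]]]; exists n.
have /choice[u fu] (i : 'I_n) : exists y : Y, f (val y) = i.
  have [x Yx fx] := fsurj i (ltn_ord i).
  by exists (SigSub (mem_set Yx)).
have fn (y : Y) : (f (val y) < n)%N by apply: fY; exact: set_valP.
exists u, (fun y => Ordinal (fn y)); apply/funext => y /=.
by apply/val_inj/finj; rewrite ?fu //; apply/mem_set; exact: set_valP.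
Qed.

(** * Triangle inequalities and reindexing for lax extensions *)

Section LaxExtensionTheory.
Variables (R : realType) (T : set_functor) (L : fuzzy_lax_extension R T).

(** The hypothesis says that [p] lies below the composite of [q] and [r], so monotonicity and (L2)
    apply. Laxity is used below only in this form. *)
Lemma lext_triangle (A B C : Sets) (p : fuzzy_rel R A C) (q : fuzzy_rel R A B)
    (r : fuzzy_rel R B C) t u v :
  (forall a b c, (p a c)%:num <= (q a b)%:num + (r b c)%:num) ->
  (lext L p t v)%:num <= (lext L q t u)%:num + (lext L r u v)%:num.
Proof.
move=> pqr; apply: le_trans (fuzzy_comp_le _ _ _ _ _).
apply: le_trans (lext_comp L q r t v).
by apply: lext_mono => a c; apply: le_fuzzy_comp.
Qed.

Lemma lext_graph0 (A B : Sets) (f : A -> B) t :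
  (lext L (fuzzy_graph R f) t (functor_map T f t))%:num <= 0.
Proof.
have := lext_graph L f t (functor_map T f t).
by rewrite {2}/fuzzy_graph fuzzy_graph_epsE.
Qed.

Lemma lext_graph_conv0 (A B : Sets) (f : A -> B) t :
  (lext L (converse (fuzzy_graph R f)) (functor_map T f t) t)%:num <= 0.
Proof.
have := lext_graph_conv L f (functor_map T f t) t.
by rewrite {2}/converse {2}/fuzzy_graph fuzzy_graph_epsE.
Qed.

(** Both inequalities are triangles through a step of cost 0: along the graph of [f] for one, along
    its converse for the other. *)
Lemma lext_reindexl (A A' B : Sets) (f : A' -> A) (r : fuzzy_rel R A B) t s :
  lext L (fun a b => r (f a) b) t s = lext L r (functor_map T f t) s.
Proof.
apply/val_inj/eqP; rewrite eq_le; apply/andP; split.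
- rewrite -[leRHS]add0r.
  apply: (le_trans (y := (lext L (fuzzy_graph R f) t (functor_map T f t))%:num +
    (lext L r (functor_map T f t) s)%:num)); last by rewrite lerD2r lext_graph0.
  apply: lext_triangle => a b c.
  by apply: le_fuzzy_graph_epsD => <-; rewrite add0r.
- rewrite -[leRHS]add0r.
  apply: (le_trans (y :=
    (lext L (converse (fuzzy_graph R f)) (functor_map T f t) t)%:num +
    (lext L (fun a b => r (f a) b) t s)%:num));
    last by rewrite lerD2r lext_graph_conv0.
  apply: lext_triangle => a b c.
  by apply: le_fuzzy_graph_epsD => <-; rewrite add0r.
Qed.

Lemma lext_reindexr (A B B' : Sets) (f : B' -> B) (r : fuzzy_rel R A B) t s :
  lext L (fun a b => r a (f b)) t s = lext L r t (functor_map T f s).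
Proof.
apply/val_inj/eqP; rewrite eq_le; apply/andP; split.
- rewrite -[leRHS]addr0.
  apply: (le_trans (y := (lext L r t (functor_map T f s))%:num +
    (lext L (converse (fuzzy_graph R f)) (functor_map T f s) s)%:num));
    last by rewrite lerD2l lext_graph_conv0.
  apply: lext_triangle => a b c; rewrite addrC.
  by apply: le_fuzzy_graph_epsD => <-; rewrite add0r.
- rewrite -[leRHS]addr0.
  apply: (le_trans (y := (lext L (fun a b => r a (f b)) t s)%:num +
    (lext L (fuzzy_graph R f) s (functor_map T f s))%:num));
    last by rewrite lerD2l lext_graph0.
  apply: lext_triangle => a b c; rewrite addrC.
  by apply: le_fuzzy_graph_epsD => <-; rewrite add0r.
Qed.

Lemma lext_le_diag (A B : Sets) (r : fuzzy_rel R A B) t u v :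
  (lext L r t v)%:num <= (lext L r t u)%:num + (lext L (diag R B) u v)%:num.
Proof.
apply: lext_triangle => a b c; rewrite addrC.
by apply: le_fuzzy_graph_epsD => ->; rewrite add0r.
Qed.

End LaxExtensionTheory.

(** * Moss liftings: monotonicity, nonexpansiveness and separation *)

Section MossLiftings.
Variables (R : realType) (T : set_functor) (L : fuzzy_lax_extension R T).

Definition pred_rel (X : Sets) n (f : 'I_n -> fpred R X) : fuzzy_rel R X 'I_n :=
  fun x i => f i x.

Lemma moss_natural n (s : T 'I_n) (X Y : Sets) (h : X -> Y)
    (f : 'I_n -> fpred R Y) :
  (fun t => lext L (pred_rel (fun i => f i \o h)) t s) =
  (fun t => lext L (pred_rel f) t s) \o functor_map T h.
Proof.
by apply/funext => t; exact: (lext_reindexl L h (pred_rel f)).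
Qed.

(* The predicates are the first argument of [L], the converse of the usual
   order: [L] need not commute with [converse], and only this order matches
   the direction of [f a - g b <= r a b]. *)
Definition moss n (s : T 'I_n) : predicate_lifting R T n :=
  PredicateLifting (@moss_natural n s).

Definition moss_set : lifting_set R T :=
  fun n lam => exists s : T 'I_n, lam = moss s.

Lemma moss_monotone : all_monotone moss_set.
Proof.
move=> n _ [s ->] X f g fg t.
by apply: lext_mono => x i; exact: fg.
Qed.

Lemma moss_preserves_nonexpansiveness : preserves_nonexpansiveness L moss_set.
Proof.
move=> n _ [s ->] A B r f g fg t1 t2.
rewrite lerBlDr; apply: lext_triangle => a b i.
by rewrite -lerBlDr; exact: fg.
Qed.

(** If [f' <= eps + g'], then [f'] lies below the composite of [diag_eps eps] and [g'], so the
    lifted values at [t] differ by at most the value of [L] on [diag_eps eps] at [(t, t)], which is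
    at most [eps]. This is used in both directions. *)
Lemma moss_nonexpansive : nonexpansive_extension L -> all_nonexpansive moss_set.
Proof.
move=> neL n _ [s ->] X f g; set M := (X in _ <= X).
have M0 : 0 <= M by exact: bigmax_sup_dist_ge0.
have moss_le (f' g' : 'I_n -> fpred R X) (eps : {i01 R}) t : 0 < eps%:num ->
    (forall i x, (f' i x)%:num <= eps%:num + (g' i x)%:num) ->
    (plift (moss s) f' t)%:num <= eps%:num + (plift (moss s) g' t)%:num.
  move=> eps0 fg'.
  apply: (le_trans (y := (lext L (diag_eps eps X) t t)%:num +
    (plift (moss s) g' t)%:num)).
    apply: lext_triangle => a b i.
    by apply: le_fuzzy_graph_epsD => <-; exact: fg'.
  have := neL X eps eps0 t t.
  by rewrite diag_epsE lerD2r.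
(* The slack [e] is there because [M] may be 0, while nonexpansiveness of [L] speaks of positive
   [eps] only. *)
apply: sup_dist_le => // t; apply/ler_addgt0Pr => e e0.
(* If [M + e] exceeds 1 it is no element of [0,1], but then it bounds any distance in [0,1]
   trivially. *)
have [eM1|] := leP (M + e) 1; last first.
  have := i01_ge0 (plift (moss s) f t); have := i01_le1 (plift (moss s) f t).
  have := i01_ge0 (plift (moss s) g t); have := i01_le1 (plift (moss s) g t).
  by move=> *; rewrite ler_norml; apply/andP; split; lra.
have eM0 : 0 <= M + e by lra.
have fgM i x : `|(f i x)%:num - (g i x)%:num| <= M by exact: le_bigmax_sup_dist.
have le_eps (f' g' : 'I_n -> fpred R X) :
    (forall i x, `|(f' i x)%:num - (g' i x)%:num| <= M) ->
    (plift (moss s) f' t)%:num <= M + e + (plift (moss s) g' t)%:num.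
  move=> fgM'; apply: (moss_le f' g' (Itv01 eM0 eM1)) => [|i x] /=.
    by lra.
  by have := fgM' i x; rewrite ler_norml => /andP[]; lra.
have fg := le_eps f g fgM.
have gf : (plift (moss s) g t)%:num <= M + e + (plift (moss s) f t)%:num.
  by apply: le_eps => i x; rewrite distrC.
by rewrite ler_norml; apply/andP; split; lra.
Qed.

Lemma kantorovich_le Lam : preserves_nonexpansiveness L Lam ->
  forall (A B : Sets) (r : fuzzy_rel R A B),
    fuzzy_le (kantorovich Lam r) (lext L r).
Proof.
move=> LamL A B r t1 t2; apply: sup01_le => _ [n [lam [f [g [lamL fg ->]]]]] /=.
by rewrite ge_max i01_ge0 andbT; exact: (LamL n lam lamL).
Qed.

(** Replaces finite subsets by families indexed by ['I_n], so that the supporting element becomes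
    the parameter of an [n]-ary Moss lifting. *)
Lemma finitary_part_ord (X : Sets) (t : T X) : finitary_part t ->
  exists n (e : 'I_n -> X) (s : T 'I_n), functor_map T e s = t.
Proof.
move=> [Y [/finite_set_retract[n [u [v uv]]] [s <-]]].
exists n, (val \o u), (functor_map T v s).
rewrite functor_map_comp /=.
by rewrite -[functor_map T u _]/((functor_map T u \o functor_map T v) s)
  -functor_map_comp uv functor_map_id.
Qed.

Lemma moss_separating : finitarily_separable L -> separating L moss_set.
Proof.
move=> hL A B r t1 t2; apply/ler_addgt0Pr => e e0.
(* One half pays for the distance from [t2] to [s], subtracted in the Kantorovich value; the other
   for the way back from [s] to [t2]. *)
have e20 : 0 < e / 2 by lra.
have [_ [/finitary_part_ord[n [h [s <-]]] t2s st2]] := hL B t2 _ e20.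
pose f (i : 'I_n) (a : A) := r a (h i).
pose g (i : 'I_n) (b : B) := diag R B b (h i).
have fg i : nonexpansive_pair r (f i) (g i).
  move=> a b; rewrite lerBlDr addrC.
  by apply: le_fuzzy_graph_epsD => ->; rewrite add0r.
have : (ominus (plift (moss s) f t1) (plift (moss s) g t2))%:num <=
    (kantorovich moss_set r t1 t2)%:num.
  by apply: sup01_ge; exists n, (moss s), f, g; split => //; exists s.
have -> : plift (moss s) f t1 = lext L r t1 (functor_map T h s).
  exact: (lext_reindexr L h r).
have -> : plift (moss s) g t2 = lext L (diag R B) t2 (functor_map T h s).
  exact: (lext_reindexr L h (diag R B)).
rewrite /= ge_max => /andP[kge _].
have := lext_le_diag L r t1 (functor_map T h s) t2.
by move: kge t2s st2 => /=; lra.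
Qed.

End MossLiftings.

(** * Kantorovich liftings of arbitrary sets of liftings, and the main result *)

Lemma lext_kantorovich (R : realType) (T : set_functor)
    (L : fuzzy_lax_extension R T) (Lam : lifting_set R T) :
  preserves_nonexpansiveness L Lam -> separating L Lam ->
  forall (A B : Sets) (r : fuzzy_rel R A B), lext L r = kantorovich Lam r.
Proof.
move=> LamL sepL A B r; apply/funext => t1; apply/funext => t2.
by apply/le_anti/andP; split; [exact: sepL | exact: kantorovich_le].
Qed.

(* A [diag_eps eps]-nonexpansive pair only gives the one-sided bound
   [f - g <= eps]; monotonicity allows replacing [f] by [max f g]. *)
Lemma kantorovich_nonexpansive (R : realType) (T : set_functor)
    (Lam : lifting_set R T) (A : Sets) (eps : {i01 R}) :
  all_monotone Lam -> all_nonexpansive Lam ->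
  fuzzy_le (kantorovich Lam (diag_eps eps A)) (diag_eps eps (T A)).
Proof.
move=> monL neL t1 t2; have [->|t12] := pselect (t1 = t2); last first.
  by rewrite [leRHS](@fuzzy_graph_eps_neq R eps _ _ id) //; exact: i01_le1.
rewrite diag_epsE.
apply: sup01_le => _ [n [lam [f [g [lamL fg ->]]]]] /=.
rewrite ge_max i01_ge0 andbT.
have fgeps i x : (f i x)%:num - (g i x)%:num <= eps%:num.
  by have := fg i x x; rewrite diag_epsE.
pose f' i x : {i01 R} := Order.max (f i x) (g i x).
have ff' i : fpred_le (f i) (f' i) by move=> x; rewrite le_max lexx.
have f'g : \big[Num.max/0]_(i < n) sup_dist (f' i) (g i) <= eps%:num.
  elim/big_ind: _ => [|x y xe ye|i _]; first exact: i01_ge0.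
    by rewrite ge_max xe ye.
  apply: sup_dist_le => [|x]; first exact: i01_ge0.
  (* The difference [f' - g] is 0 where [g] dominates and the positive [f - g] elsewhere, so its
     absolute value is at most [eps]. *)
  rewrite /f'; have [_|gf] := leP (f i x) (g i x).
    by rewrite subrr normr0 i01_ge0.
  have gf_num : (g i x)%:num < (f i x)%:num := gf.
  by rewrite gtr0_norm ?subr_gt0.
have ff'_num : (plift lam f t2)%:num <= (plift lam f' t2)%:num.
  exact: monL ff' t2.
have := le_trans (sup_dist_ge _ _ t2) (le_trans (neL n lam lamL A f' g) f'g).
by rewrite ler_norml => /andP[]; lra.
Qed.

Theorem theorem7p4 (R : realType) (T : set_functor)
    (L : fuzzy_lax_extension R T) (hL : finitarily_separable L) :
  (exists Lam : lifting_set R T,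
     [/\ all_monotone Lam,
         preserves_nonexpansiveness L Lam,
         separating L Lam &
         forall (A B : Sets) (r : fuzzy_rel R A B),
           lext L r = kantorovich Lam r])
  /\
  (nonexpansive_extension L <->
   exists Lam : lifting_set R T,
     [/\ all_monotone Lam,
         preserves_nonexpansiveness L Lam,
         separating L Lam,
         (forall (A B : Sets) (r : fuzzy_rel R A B),
           lext L r = kantorovich Lam r) &
         all_nonexpansive Lam]).
Proof.
have monM := @moss_monotone R T L.
have preM := @moss_preserves_nonexpansiveness R T L.
have sepM := moss_separating hL.
have kanM := lext_kantorovich preM sepM.
split; [|split].
- by exists (moss_set L).
- by move=> /moss_nonexpansive neM; exists (moss_set L).
(* Since [L] equals the Kantorovich lifting of [Lam], it inherits the nonexpansiveness of the
   latter. *)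
- move=> [Lam [monL _ _ kanL neL]] A eps _.
  by rewrite kanL; exact: kantorovich_nonexpansive.
Qed.
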